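(* For $n\geq 5$, let $S(P_n)$ be the splitting graph of the path $P_n$ on $n$ vertices. Then: - if $n\equiv 0 \pmod 4$, then $\frac{n+2}{2}\leq F_d[S(P_n)]\leq\frac{n+4}{2}$; - if $n\equiv 1$ or $3 \pmod 4$, then $F_d[S(P_n)]=\frac{n+3}{2}$; - if $n\equiv 2 \pmod 4$, then $F_d[S(P_n)]=\frac{n+2}{2}$.
   Context: The splitting graph $S(G)$ of a graph $G$ is obtained from $G$ by adding, for each vertex $v$ of $G$, a new vertex $v'$ and joining $v'$ to all vertices of $G$ adjacent to $v$ in $G$ (the new vertices are pairwise nonadjacent). Zero forcing: given a set $B\subseteq V(G)$ of initially black vertices (all others white) of a finite simple graph $G$, at each step a black vertex having exactly one white neighbor forces that neighbor to become black; $B$ is a zero forcing set of $G$ if repeated application of this rule turns all vertices black. A set $D\subseteq V(G)$ is dominating if every vertex of $G$ is in $D$ or adjacent to a vertex of $D$. A dom-forcing set of $G$ is a set $D_f\subseteq V(G)$ that is both a dominating set of $G$ and a zero forcing set of $G$; the dom-forcing number $F_d(G)$ is the minimum cardinality of a dom-forcing set. *)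

(* Defs.v *)
From mathcomp Require Import all_boot.

Set Implicit Arguments.
Unset Strict Implicit.
Unset Printing Implicit Defensive.

Record sgraph := SGraph {
  svertex :> finType;
  sedge : rel svertex;
  sedge_sym : symmetric sedge;
  sedge_irrefl : irreflexive sedge
}.

Section PathGraph.
Variable n : nat.

Definition path_edge (i j : 'I_n) : bool :=
  (i.+1 == j :> nat) || (j.+1 == i :> nat).

Lemma path_edge_sym : symmetric path_edge.
Proof. by move=> i j; rewrite /path_edge orbC. Qed.

Lemma path_edge_irrefl : irreflexive path_edge.
Proof. by move=> i; rewrite /path_edge orbb gtn_eqF. Qed.

Definition path_graph : sgraph := SGraph path_edge_sym path_edge_irrefl.

End PathGraph.

Section SplittingGraph.
Variable G : sgraph.

(* inl v is the original vertex v, inr v is the added vertex v' *)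
Definition splitting_edge (x y : G + G) : bool :=
  match x, y with
  | inl u, inl v => sedge u v
  | inl u, inr v => sedge u v
  | inr u, inl v => sedge u v
  | inr _, inr _ => false
  end.

Lemma splitting_edge_sym : symmetric splitting_edge.
Proof. by move=> [u|u] [v|v] //=; apply: sedge_sym. Qed.

Lemma splitting_edge_irrefl : irreflexive splitting_edge.
Proof. by move=> [u|u] //=; apply: sedge_irrefl. Qed.

Definition splitting_graph : sgraph :=
  SGraph splitting_edge_sym splitting_edge_irrefl.

End SplittingGraph.

Section DomForcing.
Variable G : sgraph.
Implicit Types (B D : {set G}) (u v : G).

(* With B the set of black vertices, u is black and v is its unique white
   neighbour. *)
Definition forces B u v : bool :=
  (u \in B) && ([set w | sedge u w & w \notin B] == [set v]).

Definition forcing_step : rel {set G} :=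
  fun B B' => [exists u, exists v, forces B u v && (B' == v |: B)].

Definition zero_forcing B : bool := connect forcing_step B [set: G].

Definition dominating D : bool :=
  [forall v, (v \in D) || [exists u in D, sedge v u]].

Definition dom_forcing D : bool := dominating D && zero_forcing D.

(* The minimum is over a nonempty family: the whole vertex set is
   dom-forcing. *)
Lemma dom_forcingT : dom_forcing [set: G].
Proof.
rewrite /dom_forcing /zero_forcing connect0 andbT.
by apply/forallP => v; rewrite in_setT.
Qed.

Definition dom_forcing_number : nat :=
  #|[arg min_(D < [set: G] | dom_forcing D) #|D| ]|.

Lemma dom_forcing_number_min D : dom_forcing D -> dom_forcing_number <= #|D|.
Proof.
rewrite /dom_forcing_number.
by case: arg_minnP => [|D0 _ minD0]; [apply: dom_forcingT | apply: minD0].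
Qed.

Lemma dom_forcing_number_attained :
  exists2 D, dom_forcing D & #|D| = dom_forcing_number.
Proof.
rewrite /dom_forcing_number.
by case: arg_minnP => [|D0 ? _]; [apply: dom_forcingT | exists D0].
Qed.

End DomForcing.

(* Main.v *)
Require Import Defs.
From mathcomp Require Import all_boot.
From mathcomp Require Import zify.

(** An original black vertex covers the added vertices v' of its (at most two)
    neighbours, and an added black vertex covers only itself; a dominating set
    covers every added vertex.  If 2 |D| <= n + 1 then this covering has a
    total slack (overlaps, added vertices in D, ends of the path in D) of at
    most one, so that D is so regular that forcing stops almost at once.
    Hence n + 2 <= 2 |D| for every dom-forcing set.  Conversely the two twins
    0, 0' of an end of the path already form a zero forcing set, since they
    force 1, 1', 2, 2', ... in turn; it then suffices to add the dominating
    pattern 3, 4, 7, 8, ... with a correction at the other end. *)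

Set Implicit Arguments.
Unset Strict Implicit.
Unset Printing Implicit Defensive.

(** * Criteria for zero forcing in an arbitrary graph *)

Section ZeroForcing.
Variable G : sgraph.
Implicit Types (B C D : {set G}) (u v : G).

(** Each force blackens one more vertex, so induction on the number of white vertices reaches the
    full set. *)
Lemma zero_forcing_progress D :
    (forall B, D \subset B -> B != [set: G] -> exists u v, forces B u v) ->
  zero_forcing D.
Proof.
move=> prog; rewrite /zero_forcing.
suff H k B : #|~: B| <= k -> D \subset B ->
  connect (@forcing_step G) B [set: G] by apply: (H #|~: D|).
elim: k B => [|k IHk] B.
  rewrite leqn0 cards_eq0 -(inj_eq (@setC_inj _)) setCK setC0 => /eqP -> _.
  exact: connect0.
move=> leBk sDB; have [-> | nB] := eqVneq B [set: G]; first exact: connect0.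
have [u [v fuv]] := prog B sDB nB.
have vB : v \notin B.
  case/andP: fuv => _ /eqP/setP/(_ v).
  by rewrite !inE eqxx => /andP[].
apply: connect_trans (IHk (v |: B) _ _).
- apply: connect1; apply/existsP; exists u; apply/existsP; exists v.
  by rewrite fuv eqxx.
- move: leBk; rewrite (cardsD1 v) inE vB add1n ltnS setCU setIC.
  by rewrite -setDE.
- exact: subset_trans sDB (subsetU1 _ _).
Qed.

(** Black sets never leave [C]: if some black [u] inside [C] forced a vertex outside [C], that
    vertex would also be the only neighbour of [u] outside [C], so [C] would not be stalled. *)
Lemma stalled_not_zero_forcing C D :
    D \subset C -> C != [set: G] -> (forall u v, ~~ forces C u v) ->
  ~~ zero_forcing D.
Proof.
move=> sDC nC stall; apply: contra nC => /connectP[s].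
elim: s D sDC => [|B s IHs] D sDC /= => [_ TD|].
  by rewrite -subTset TD.
case/andP=> /existsP[u /existsP[v /andP[fuv /eqP ->]]].
apply: IHs; rewrite subUset sub1set sDC andbT.
apply: contraR (stall u v) => vC; apply/andP.
case/andP: fuv => uD /eqP/setP wD; split; first exact: (subsetP sDC).
apply/eqP/setP=> w; rewrite !inE; apply/idP/eqP => [/andP[uw wC] | ->].
  apply/set1P; rewrite -wD !inE uw; apply: contra wC.
  exact: (subsetP sDC).
by move: (wD v); rewrite !inE eqxx vC => /andP[->].
Qed.

End ZeroForcing.

(** * Stalled sets in the splitting graph of a path *)

Section SplittingPath.
Variable n : nat.
Local Notation G := (splitting_graph (path_graph n)).
Implicit Types (D : {set G}).

(* A set of black vertices of S(P_n) is given by [p] on the vertices of the path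
   and [q] on the added ones; the sums count the white neighbours. *)
Lemma stalled_splitting_path D (p q : pred nat) :
    (forall i : 'I_n, (inl i : G) \in D -> p i) ->
    (forall i : 'I_n, (inr i : G) \in D -> q i) ->
    (exists2 i, i < n & ~~ q i) ->
    (forall i, i < n -> p i ->
       ((0 < i) && ~~ p i.-1) + ((0 < i) && ~~ q i.-1)
       + ((i.+1 < n) && ~~ p i.+1) + ((i.+1 < n) && ~~ q i.+1) != 1) ->
    (forall i, i < n -> q i ->
       ((0 < i) && ~~ p i.-1) + ((i.+1 < n) && ~~ p i.+1) != 1) ->
  ~~ zero_forcing D.
Proof.
move=> Dp Dq [i0 lt_i0 nq] stp stq.
pose C : {set G} := [set x : G | match x with inl i => p i | inr i => q i end].
have Cl (i : 'I_n) : ((inl i : G) \in C) = p i by rewrite inE.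
have Cr (i : 'I_n) : ((inr i : G) \in C) = q i by rewrite inE.
apply: (@stalled_not_zero_forcing _ C).
- by apply/subsetP => -[] i; rewrite ?Cl ?Cr; [apply: Dp | apply: Dq].
- apply: contraNneq nq => /setP/(_ (inr (Ordinal lt_i0))).
  by rewrite Cr inE.
move=> u v; apply/negP => /andP[uC /eqP/setP wC].
have W w : sedge u w && (w \notin C) = (w == v) by have := wC w; rewrite !inE.
have vP : sedge u v && (v \notin C) by rewrite W.
have Wl (j : 'I_n) : sedge u (inl j) && ~~ p j = (inl j == v) by rewrite -Cl W.
have Wr (j : 'I_n) : sedge u (inr j) && ~~ q j = (inr j == v) by rewrite -Cr W.
case: u uC {wC W} Wl Wr vP => i; rewrite ?Cl ?Cr => pi /= Wl Wr.
- have := stp i (ltn_ord i) pi => {stp stq}.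
  case: v Wl Wr => j Wl Wr; rewrite /= ?Cl ?Cr /path_edge => hs hv.
  + have Kl k : k < n -> ((i.+1 == k) || (k.+1 == i)) && ~~ p k = (k == j).
      by move=> lt_k; apply: (Wl (Ordinal lt_k)).
    have Kr k : k < n -> ((i.+1 == k) || (k.+1 == i)) && ~~ q k = false.
      by move=> lt_k; apply: (Wr (Ordinal lt_k)).
    move: (Kl i.-1) (Kl i.+1) (Kr i.-1) (Kr i.+1) hs hv (ltn_ord i) (ltn_ord j).
    lia.
  + have Kl k : k < n -> ((i.+1 == k) || (k.+1 == i)) && ~~ p k = false.
      by move=> lt_k; apply: (Wl (Ordinal lt_k)).
    have Kr k : k < n -> ((i.+1 == k) || (k.+1 == i)) && ~~ q k = (k == j).
      by move=> lt_k; apply: (Wr (Ordinal lt_k)).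
    move: (Kl i.-1) (Kl i.+1) (Kr i.-1) (Kr i.+1) hs hv (ltn_ord i) (ltn_ord j).
    lia.
- have := stq i (ltn_ord i) pi => {stp stq}.
  case: v Wl {Wr} => j Wl; rewrite /= ?Cl ?Cr /path_edge // => hs hv.
  have Kl k : k < n -> ((i.+1 == k) || (k.+1 == i)) && ~~ p k = (k == j).
    by move=> lt_k; apply: (Wl (Ordinal lt_k)).
  move: (Kl i.-1) (Kl i.+1) hs hv (ltn_ord i) (ltn_ord j).
  lia.
Qed.

End SplittingPath.

(** * Load counting and the lower bound *)

(* How often the added vertex i' is covered, plus one if i' is black (it covers
   only once) and one if i is a black end of the path (it covers only once);
   with these corrections the loads add up to 2 |D|. *)
Definition load (n : nat) (a b : pred nat) (i : nat) : nat :=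
  2 * b i + ((0 < i) && a i.-1) + ((i.+1 < n) && a i.+1)
  + ((i == 0) && a 0) + ((i.+1 == n) && a i).

Lemma sum_load n (a b : pred nat) :
  \sum_(i < n) load n a b i = 2 * \sum_(i < n) (a i + b i).
Proof.
case: n => [|n]; first by rewrite !big_ord0.
have Hl : \sum_(i < n.+1) ((0 < i) && a i.-1) + a n = \sum_(i < n.+1) a i.
  by rewrite big_ord_recl add0n [RHS]big_ord_recr.
have Hr : \sum_(i < n.+1) ((i.+1 < n.+1) && a i.+1) + a 0 = \sum_(i < n.+1) a i.
  rewrite big_ord_recr /= ltnn addn0 [RHS]big_ord_recl addnC; congr (_ + _).
  by apply: eq_bigr => i _; rewrite ltnS ltn_ord.
have H0 : \sum_(i < n.+1) ((i == 0 :> nat) && a 0) = a 0.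
  by rewrite big_ord_recl big1 ?addn0.
have Hn : \sum_(i < n.+1) ((i.+1 == n.+1) && a i) = a n.
  rewrite big_ord_recr /= eqxx big1 // => i _.
  by rewrite eqSS ltn_eqF.
rewrite /load !big_split /= H0 Hn big1_eq; move: Hl Hr.
  set A := \sum_(i < _) a i; set B := \sum_(i < _) b i.
  set X := \sum_(i < _) _; set Y := \sum_(i < _) _; lia.
Qed.

(** All loads are at least 1 and their sum is at most n + 1, so the total excess over 1 is at most
    1, and two indices share it. *)
Lemma two_loads_le n (a b : pred nat) i j :
    (forall k, k < n -> 0 < load n a b k) ->
    2 * \sum_(k < n) (a k + b k) <= n.+1 -> i < n -> j < n -> i != j ->
  load n a b i + load n a b j <= 3.
Proof.
move=> load_gt0; rewrite -sum_load => le_sum lt_i lt_j neq_ij.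
have : \sum_(k < n) (load n a b k - 1) <= 1.
  rewrite sumnB => [|k _]; last exact: load_gt0.
  by rewrite sum_nat_const card_ord muln1 leq_subLR addn1.
rewrite (bigD1 (Ordinal lt_i)) //= (bigD1 (Ordinal lt_j)) /=; last first.
  by rewrite eq_sym.
have := load_gt0 i lt_i; have := load_gt0 j lt_j; lia.
Qed.

(** In each case an explicit proper superset of [D] is stalled; the load bounds and the case
    hypotheses keep its white vertices out of [D]. *)
Lemma light_not_zero_forcing n (D : {set splitting_graph (path_graph n)})
    (a b : pred nat) :
    5 <= n ->
    (forall i : 'I_n, (inl i : splitting_graph (path_graph n)) \in D -> a i) ->
    (forall i : 'I_n, (inr i : splitting_graph (path_graph n)) \in D -> b i) ->
    (forall i, i < n ->
       [|| b i, (0 < i) && a i.-1 | (i.+1 < n) && a i.+1]) ->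
    (forall i j, i < n -> j < n -> i != j -> load n a b i + load n a b j <= 3) ->
  ~~ zero_forcing D.
Proof.
move=> hn Da Db cov L.
have load_gt0 i : i < n -> 0 < load n a b i.
  by move=> /cov; rewrite /load; lia.
have le2 i : i < n -> load n a b i <= 2.
  move=> lt_i; have [i0|i0] := eqVneq i 0.
    have := L i 1; have := load_gt0 1; lia.
  have := L i 0; have := load_gt0 0; lia.
(* D contains an added vertex j' with 0 < j < n - 1: nothing can be forced. *)
have [/existsP[[j lt_j] /= /and3P[j0 jn bj]] | nob] :=
  boolP [exists j : 'I_n, [&& 0 < j, j.+1 < n & b j]].
  have Lj i : i < n -> i != j -> load n a b i <= 1.
    move=> lt_i ij; have := L i j lt_i lt_j ij; rewrite /load bj; lia.
  (* Both neighbours of j' are white. A black path vertex is neither an end nor a neighbour of j',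
     so it sees two white added vertices. *)
  apply: (@stalled_splitting_path _ _
    [pred x | (x != 0) && (x.+1 != n) && (x.+1 != j) && (x != j.+1)]
    (pred1 j)) => /=.
  - move=> [i lt_i] /Da /= ai; rewrite -!andbA; apply/and4P; split.
    + apply: contraTneq ai => ->; have := Lj 0; have := cov 0; rewrite /load /=; lia.
    + apply: contraTneq ai => i_n; have := Lj i; have := cov i.
      rewrite /load i_n /=; lia.
    + apply: contraTneq ai => i_j; have := le2 j lt_j; rewrite /load bj -{2}i_j /=; lia.
    + apply: contraTneq ai => ->; have := le2 j lt_j; rewrite /load bj jn /=; lia.
  - move=> [i lt_i] /Db /= bi; apply/negPn/negP=> /(Lj i lt_i).
    by rewrite /load bi.
  - by exists 0; lia.
  - by move=> i lt_i; lia.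
  - by move=> i lt_i; lia.
have nob' i : 0 < i -> i.+1 < n -> b i = false.
  move=> i0 lt_i; apply: contraNF nob => bi.
  by apply/existsP; exists (Ordinal (ltnW lt_i)); rewrite /= i0 lt_i.
(* D contains the end 0: only 1' and then 2 are forced. *)
have [a0|na0] := boolP (a 0).
  have [b0 a1] : ~~ b 0 /\ a 1.
    by have := le2 0; have := cov 0; rewrite /load a0 /=; lia.
  have le1 i : 0 < i -> i < n -> load n a b i <= 1.
    by move=> i0 lt_i; have := L 0 i; rewrite {1}/load a0 a1 /=; lia.
  (* Vertex 3 is not in [D], since 2' is already covered by 1; a black far end would give its twin
     load at least 2. After 1' and 2 are forced, 2 still sees the white pair 3, 3'. *)
  apply: (@stalled_splitting_path _ _ [pred x | (x != 3) && (x.+1 != n)]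
    (pred1 1)) => /=.
  - move=> [i lt_i] /Da /= ai; apply/andP; split.
      apply: contraTneq ai => ->.
      by have := le1 2; rewrite /load a1 /=; lia.
    apply: contraTneq ai => i_n; have := le1 i; have := cov i.
    by rewrite /load i_n /=; lia.
  - move=> [[|i] lt_i] /Db /= bi; first by rewrite bi in b0.
    by have := le1 i.+1; rewrite /load bi; lia.
  - by exists 0; lia.
  - by move=> i lt_i; lia.
  - by move=> i lt_i; lia.
(* The mirror image of the previous case. *)
have [an|nan] := boolP (a n.-1).
  have [bn an2] : ~~ b n.-1 /\ a n.-2.
    by have := le2 n.-1; have := cov n.-1; rewrite /load an /=; lia.
  have le1 i : i.+1 < n -> load n a b i <= 1.
    by move=> lt_i; have := L n.-1 i; rewrite {1}/load an an2 /=; lia.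
  apply: (@stalled_splitting_path _ _ [pred x | (x != n - 4) && (x != 0)]
    (pred1 n.-2)) => /=.
  - move=> [i lt_i] /Da /= ai; apply/andP; split; last first.
      by apply: contraTneq ai => ->.
    apply: contraTneq ai => ->; have := le1 (n - 3).
    have -> : n - 4 = (n - 3).-1 by lia.
    have n2 : n.-2 = (n - 3).+1 by lia.
    by rewrite n2 in an2; rewrite /load an2; lia.
  - move=> [i lt_i] /Db /= bi; have [i_n|i_n] := eqVneq i n.-1.
      by rewrite -i_n bi in bn.
    by have := le1 i; rewrite /load bi; lia.
  - by exists n.-1; lia.
  - by move=> i lt_i; lia.
  - by move=> i lt_i; lia.
(* D contains at most one of 0', (n - 1)': only its neighbour is forced. *)
have nbb : ~~ (b 0 && b n.-1).
  by apply/negP => /andP[b0 bn]; have := L 0 n.-1; rewrite /load b0 bn; lia.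
(* An inner path vertex with both adjacent added vertices white is stuck; only 1 and n - 2 may see a
   black one. *)
apply: (@stalled_splitting_path _ _ [pred x | (x != 0) && (x != n.-1)] b) => //=.
- move=> i /Da ai; apply/andP; split; apply: contraTneq ai => -> //.
- by exists 1; [lia | rewrite nob' //; lia].
- move=> i lt_i /andP[i0 i_n].
  (* Vertex 1 sees the white vertices 0 and 2', whether or not 0' is black; n - 2 is symmetric. *)
  have [->|i1] := eqVneq i 1.
    by rewrite (nob' 2) /=; lia.
  have nb1 : b i.-1 = false by rewrite nob' //; lia.
  have [i2|i2] := eqVneq i n.-2; first by rewrite nb1; lia.
  by rewrite nb1 (nob' i.+1) //; lia.
move=> i lt_i bi; have [->|i0] := eqVneq i 0; first by lia.
have [->|i1] := eqVneq i n.-1; first by lia.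
by rewrite nob' in bi; lia.
Qed.

Lemma dom_forcing_splitting_path_lb n (D : {set splitting_graph (path_graph n)}) :
  5 <= n -> dom_forcing D -> n.+2 <= 2 * #|D|.
Proof.
move=> hn /andP[/forallP dom]; apply: contraTT; rewrite -ltnNge ltnS => le_D.
(* Membership in [D] becomes predicates on [nat], false from [n] on. *)
pose a (i : nat) :=
  if insub i is Some k then (inl k : splitting_graph (path_graph n)) \in D
  else false.
pose b (i : nat) :=
  if insub i is Some k then (inr k : splitting_graph (path_graph n)) \in D
  else false.
have aE (i : 'I_n) : ((inl i : splitting_graph (path_graph n)) \in D) = a i.
  by rewrite /a valK.
have bE (i : 'I_n) : ((inr i : splitting_graph (path_graph n)) \in D) = b i.
  by rewrite /b valK.
have cardD : #|D| = \sum_(i < n) (a i + b i).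
  rewrite -sum1_card big_mkcond big_sumType /= big_split /=.
  by congr (_ + _); apply: eq_bigr => i _; rewrite ?aE ?bE; case: ifP.
have cov i : i < n -> [|| b i, (0 < i) && a i.-1 | (i.+1 < n) && a i.+1].
  move=> lt_i; have := dom (inr (Ordinal lt_i)).
  rewrite bE => /orP[/= -> // | /existsP[[j|j] /andP[]] //].
  rewrite aE /= /path_edge /= => aj adj.
  move: (ltn_ord j) aj; case/orP: adj => /eqP <- /= lt_j ->.
    by rewrite lt_j !orbT.
  by rewrite orbT.
rewrite cardD in le_D; apply: (@light_not_zero_forcing n D a b hn) => // [i|i|i j].
- by rewrite aE.
- by rewrite bE.
apply: two_loads_le => // k /cov; rewrite /load; lia.
Qed.

(** * The upper bound by an explicit dom-forcing set *)

Section UpperBound.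
Variable m : nat.
Let n := m.+1.
Local Notation G := (splitting_graph (path_graph n)).

(** Let j be the first index with j or j' white. If j is white, (j - 1)' forces it, as its only
    other possible neighbour j - 2 is black; otherwise j - 1 forces j'. *)
Lemma zero_forcing_end_twins (D : {set G}) :
  (inl ord0 : G) \in D -> (inr ord0 : G) \in D -> zero_forcing D.
Proof.
move=> D0 D0'; apply: zero_forcing_progress => B sDB nB.
pose white i := [exists j : 'I_n, (j == i :> nat) &&
  (((inl j : G) \notin B) || ((inr j : G) \notin B))].
have ex_white : exists i, white i.
  have [|x _ xB] := subsetPn (_ : ~~ ([set: G] \subset B)).
    by rewrite subTset.
  by case: x xB => j jB; exists j; apply/existsP; exists j;
    rewrite eqxx jB ?orbT.
case: (ex_minnP ex_white) => i /existsP[j /andP[/eqP ji jB]] min_i.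
have blackP (k : 'I_n) : k < j -> ((inl k : G) \in B) /\ ((inr k : G) \in B).
  move=> lt_kj; apply/andP; rewrite -[_ && _]negbK negb_and.
  apply/negP => kB; have : i <= k by apply: min_i; apply/existsP; exists k; rewrite eqxx.
  by rewrite -ji leqNgt lt_kj.
have j0 : 0 < j.
  rewrite lt0n; apply: contraTneq jB => j0.
  have -> : j = ord0 by apply: val_inj.
  by rewrite !(subsetP sDB).
have lt_j1 : j.-1 < n by rewrite (leq_ltn_trans (leq_pred _)).
pose k := Ordinal lt_j1; have kj : k < j by rewrite /= prednK.
have [kB kB'] := blackP k kj.
have [jl|jl] := boolP ((inl j : G) \in B).
  rewrite jl /= in jB; exists (inl k), (inr j).
  rewrite /forces kB; apply/eqP/setP=> -[] l; rewrite !inE /=.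
    apply/negP=> /andP[/orP[] /eqP /= e]; apply/negP; rewrite negbK.
      by have -> : l = j by apply: val_inj; rewrite /= -e prednK.
    by apply: (proj1 (blackP l _)); lia.
  apply/idP/eqP => [/andP[/orP[] /eqP /= e] nl | [->]].
  - by congr inr; apply: val_inj; rewrite /= -e prednK.
  - by case/negP: nl; apply: (proj2 (blackP l _)); lia.
  - by rewrite jB andbT /path_edge /= prednK // eqxx.
exists (inr k), (inl j).
rewrite /forces kB'; apply/eqP/setP=> -[] l; rewrite !inE //=.
apply/idP/eqP => [/andP[/orP[] /eqP /= e] nl | [->]].
- by congr inl; apply: val_inj; rewrite /= -e prednK.
- by case/negP: nl; apply: (proj1 (blackP l _)); lia.
- by rewrite jl andbT /path_edge /= prednK // eqxx.
Qed.

End UpperBound.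

(** The residue 3 contributes the first quotient, the positive multiples of 4 the second. *)
Lemma card_mod4_inner n :
  0 < n -> #|[set i : 'I_n | (3 <= i) && ((i %% 4 == 3) || (i %% 4 == 0))]|
           = n %/ 4 + n.-1 %/ 4.
Proof.
case: n => // n _; rewrite cardsE -sum1_card big_mkcond /=.
elim: n => [|n IHn]; first by rewrite big_ord_recl big_ord0.
rewrite big_ord_recr /= IHn unfold_in /=; case: ifP; lia.
Qed.

Lemma dom_forcing_splitting_path_ub n :
  5 <= n ->
  dom_forcing_number (splitting_graph (path_graph n))
    <= 2 + (n %/ 4 + n.-1 %/ 4) + ((n %% 4 == 3) || (n %% 4 == 0)).
Proof.
case: n => // n hn; set G := splitting_graph _.
pose A := [set i : 'I_n.+1 | (3 <= i) && ((i %% 4 == 3) || (i %% 4 == 0))].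
(* The last added vertex has [n.-1] as its only neighbour, which lies in [A] exactly when [n.+1] is
   1 or 2 mod 4; [E] supplies it otherwise. *)
pose E := [set i : 'I_n.+1 | (i.+1 == n) && ((n.+1 %% 4 == 3) || (n.+1 %% 4 == 0))].
pose D : {set G} := [set inl ord0; inr ord0] :|: inl @: (A :|: E).
have inlD (i : 'I_n.+1) : ((inl i : G) \in D) = [|| i == ord0, i \in A | i \in E].
  rewrite !inE mem_imset ?inE; last exact: inl_inj.
  by rewrite /= orbF.
have leD : #|D| <= 2 + (n.+1 %/ 4 + n %/ 4) + ((n.+1 %% 4 == 3) || (n.+1 %% 4 == 0)).
  rewrite (leq_trans (leq_card_setU _ _)) // -addnA leq_add ?cards2 //.
  rewrite card_imset; last exact: inl_inj.
  rewrite (leq_trans (leq_card_setU _ _)) // leq_add ?(@card_mod4_inner n.+1) //.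
  have lt_n : n.-1 < n.+1 by lia.
  apply: leq_trans (_ : #|[set i in [:: Ordinal lt_n] | (n.+1 %% 4 == 3) || (n.+1 %% 4 == 0)]| <= _).
    apply: subset_leq_card; apply/subsetP => i; rewrite !inE => /andP[/eqP e ->].
    by rewrite andbT -val_eqE /=; apply/eqP; lia.
  case: (_ || _); last by rewrite leqn0 cards_eq0; apply/eqP/setP=> i; rewrite !inE andbF.
  by rewrite (leq_trans (subset_leq_card (_ : _ \subset [set Ordinal lt_n]))) ?cards1 //;
    apply/subsetP => i; rewrite !inE andbT.
apply: leq_trans leD; apply: dom_forcing_number_min; apply/andP; split; last first.
  by apply: zero_forcing_end_twins; rewrite !inE eqxx.
have nbr i : 0 < i -> i < n.+1 ->
    exists2 j : 'I_n.+1, (inl j : G) \in D & (j.+1 == i) || (i.+1 == j).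
  move=> i0 lt_i.
  have [k lt_k [Dk adj]] : exists2 k, k < n.+1 &
     ([|| k == 0, (3 <= k) && ((k %% 4 == 3) || (k %% 4 == 0)) |
          (k.+1 == n) && ((n.+1 %% 4 == 3) || (n.+1 %% 4 == 0))]
      /\ ((k.+1 == i) || (i.+1 == k))).
    (* Indices congruent to 2 or 3 are dominated from the right, the others from the left; the last
       index always uses [n.-1]. *)
    have [up|up] := boolP ((i.+1 < n.+1) && ((i.+1 %% 4 == 3) || (i.+1 %% 4 == 0))).
      by exists i.+1; lia.
    by exists i.-1; lia.
  by exists (Ordinal lt_k) => //; rewrite inlD !inE.
(* Twins have the same original neighbours, so one index [j] dominates both. *)
apply/forallP => x; have [i xE] : exists i : 'I_n.+1, x = inl i \/ x = inr i.
  by case: x => i; exists i; [left | right].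
have [i0 | i0] := posnP i.
  have i00 : i = ord0 by apply: val_inj.
  by case: xE => ->; rewrite i00 !inE eqxx ?orbT.
have [j Dj adj] := nbr i i0 (ltn_ord i).
apply/orP; right; apply/existsP; exists (inl j); rewrite Dj.
by case: xE => -> /=; rewrite /path_edge orbC.
Qed.

(* Each congruence condition on n makes the corresponding division exact. *)
Theorem theorem5p7 (n : nat) (hn : 5 <= n) :
  [/\ n %% 4 = 0 ->
        (n + 2) %/ 2 <= dom_forcing_number (splitting_graph (path_graph n))
          <= (n + 4) %/ 2,
      n %% 4 = 1 \/ n %% 4 = 3 ->
        dom_forcing_number (splitting_graph (path_graph n)) = (n + 3) %/ 2
    & n %% 4 = 2 ->
        dom_forcing_number (splitting_graph (path_graph n)) = (n + 2) %/ 2].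
Proof.
have := dom_forcing_splitting_path_ub hn.
have [D domD <-] := dom_forcing_number_attained (splitting_graph (path_graph n)).
have := dom_forcing_splitting_path_lb hn domD.
by split; lia.
Qed.
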